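(* Let $f\in(3')$ be as in the context, and let $g=m(s,s')-m(s',s)$ with $s,s'\in\Sigma$, $s>s'$, $m_{ss'}<\infty$, so $\bar g=m(s,s')$. Let $0\le i\le k-1$ and suppose $$\bar f=u_0\cdots u_{i-1}\,(m-2)(s_i,s'_i)\,\bar g\,(m-2)(s'_{i+2},s_{i+2})\,u_{i+3}\cdots u_{k+1}y_{k+1},$$ where $u_0\cdots u_{i-1}=1$ if $i=0$ and $u_{i+3}\cdots u_{k+1}=1$ if $i=k-1$. Let $(f,g)_{\bar f}$ be the inclusion composition for this occurrence of $\bar g$. Then: (i) $g=x_is_{i+1}x_i-s_{i+1}x_is_{i+1}$ and $x_i>s_{i+1}$. (ii) $(f,g)_{\bar f}\equiv0$ if $|u_i|=1$ or $|u_i|=2$. (iii) If $|u_i|>2$, then $$(f,g)_{\bar f}\equiv u_0\cdots u_{i-1}(m-3)(s_i,s'_i)s_{i+1}s'_{i+1}x_is_{i+1}\,(m-2)(s'_{i+2},x_i)u_{i+3}\cdots u_{k+1}y_{k+1}-s'_0u_0\cdots u_{k+1}.$$ Here $\equiv$ is congruence modulo $(S,\bar f)$.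
   Context: Coxeter setting. $\Sigma=\{\sigma_1,\dots,\sigma_n\}$ is finite, $(m_{ij})$ is a Coxeter matrix (symmetric, $m_{ii}=1$, $2\le m_{ij}\le\infty$ for $i\neq j$); for $s=\sigma_i,s'=\sigma_j$ write $m_{ss'}=m_{ij}$. $\Sigma^*$ is the free monoid (empty word $1$) with the deg-lex ordering (length first, then lexicographic with $\sigma_1<\dots<\sigma_n$); $|u|$ is word length; $\bar f$ is the largest word of $f\in F\langle\Sigma\rangle$, $F$ a field. For finite $m_{ss'}$, $m(s,s')$ is the alternating word $ss's\cdots$ of length $m_{ss'}$ and $(m-t)(s,s')$ the alternating word $ss's\cdots$ of length $m_{ss'}-t$ ($m$ refers to the pair in parentheses). $S$ is the union of: $(1)$ all $s^2-1$, $s\in\Sigma$; $(2)$ all $m(s,s')-m(s',s)$, $s>s'$, $m_{ss'}<\infty$; $(3')$ all $(m-1)(s_0,s_0')\cdots(m-1)(s_k,s_k')m(s_{k+1},s'_{k+1})-m(s'_0,s_0)(m-1)(s_1,s_1')\cdots(m-1)(s_{k+1},s'_{k+1})$ with $k\ge0$, $s_j,s_j'\in\Sigma$, all $m_{s_js_j'}$ finite, where for $0\le j\le k$: $s'_{j+1}=s'_j$ if $m_{s_js'_j}$ is even, $s'_{j+1}=s_j$ if it is odd; $s_0>s'_0$, $s_j<s'_j$ for $1\le j\le k+1$; $\{s_j,s'_j\}\ne\{s_{j+1},s'_{j+1}\}$ for $0\le j\le k$. Notation. $f\in(3')$ has data $s_j,s'_j$ $(0\le j\le k+1)$; $u_j=(m-1)(s_j,s'_j)$,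 $x_j$ is the last letter of $u_j$, $y_j$ the last letter of $m(s_j,s_j')$. Thus $f=u_0\cdots u_{k+1}y_{k+1}-s'_0u_0\cdots u_{k+1}$ and $\bar f=u_0\cdots u_{k+1}y_{k+1}$. If $\bar f=a\bar gb$, the inclusion composition is $(f,g)_{\bar f}=f-agb$. $h\equiv h'$ modulo $(S,\bar f)$ means $h-h'=\sum\alpha_ra_rs_rb_r$ with $\alpha_r\in F$, $s_r\in S$, $a_r,b_r\in\Sigma^*$, $a_r\overline{s_r}b_r<\bar f$. *)

(* Defs.v *)
From HB Require Import structures.
From mathcomp Require Import all_boot all_order all_algebra.
From mathcomp Require Import finmap.
From mathcomp.multinomials Require Import monalg.

Set Implicit Arguments.
Unset Strict Implicit.
Unset Printing Implicit Defensive.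

Import Order.TTheory GRing.Theory.
Local Open Scope ring_scope.

(* The alphabet {sigma_1 < ... < sigma_n} is 'I_n, a word is a [seq 'I_n], and
   the free algebra F<Sigma> is the monoid algebra of the free monoid. *)
Notation "'{freealg' F [ n ] }" := {malg F[{fmonom 'I_n}]}
  (at level 0, F, n at level 2, format "'{freealg'  F [ n ] }") : type_scope.

Definition word (F : fieldType) (n : nat) (w : seq 'I_n) : {freealg F[n]} :=
  << 1 *g FMonom w >>.

Section DegLex.
Variable n : nat.
Implicit Types u v : seq 'I_n.

Definition dlle u v : bool :=
  (size u < size v)%N ||
  ((size u == size v) && ((u : seqlexi 'I_n) <= (v : seqlexi 'I_n))%O).

Definition dllt u v : bool := (u != v) && dlle u v.

Definition dlmax u v := if dlle u v then v else u.

End DegLex.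

(* Junk value: the empty word when f = 0. *)
Definition lead (F : fieldType) (n : nat) (f : {freealg F[n]}) : seq 'I_n :=
  \big[@dlmax n/[::]]_(w <- msupp f) fmonom_val w.

Section DegLexFacts.
Variable n : nat.
Implicit Types u v w : seq 'I_n.

Lemma dlle_refl u : dlle u u.
Proof. by rewrite /dlle eqxx lexx orbT. Qed.

Lemma dlle_nil u : dlle [::] u.
Proof. by case: u => [|x u] //; exact: dlle_refl. Qed.

Lemma dlle_total u v : dlle u v || dlle v u.
Proof.
rewrite /dlle; case: ltngtP => //= _.
exact: (@le_total _ (seqlexi 'I_n)).
Qed.

Lemma dlle_trans v u w : dlle u v -> dlle v w -> dlle u w.
Proof.
rewrite /dlle => /orP[uv|/andP[/eqP uv luv]] /orP[vw|/andP[/eqP vw lvw]].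
- by rewrite (ltn_trans uv vw).
- by rewrite -vw uv.
- by rewrite uv vw.
- rewrite uv vw eqxx ltnn /=.
  exact: (@le_trans _ (seqlexi 'I_n) v).
Qed.

Lemma dlle_anti u v : dlle u v -> dlle v u -> u = v.
Proof.
rewrite /dlle; case: ltngtP => //= _ uv vu.
by apply: (@le_anti _ (seqlexi 'I_n)); rewrite uv vu.
Qed.

Lemma dlmaxP u v w : dlle w (dlmax u v) = dlle w u || dlle w v.
Proof.
rewrite /dlmax; case: ifP => uv.
  by apply/idP/orP => [->|[/dlle_trans/(_ uv)|]]; [right| |].
have vu : dlle v u by have := dlle_total u v; rewrite uv.
by apply/idP/orP => [->|[|/dlle_trans/(_ vu)]]; [left| |].
Qed.

Lemma dlmax_seq_ge (r : seq {fmonom 'I_n}) (w : {fmonom 'I_n}) :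
  w \in r -> dlle w (\big[@dlmax n/[::]]_(v <- r) fmonom_val v).
Proof.
elim: r => // x r IH; rewrite in_cons big_cons dlmaxP.
by case/orP => [/eqP ->|/IH ->]; rewrite ?dlle_refl ?orbT.
Qed.

Lemma dlmax_seq_mem (r : seq {fmonom 'I_n}) :
  r != [::] -> FMonom (\big[@dlmax n/[::]]_(v <- r) fmonom_val v) \in r.
Proof.
elim: r => // x r IH _; rewrite big_cons in_cons /dlmax.
case: ifP => [le|_]; last by rewrite -(inj_eq val_inj) eqxx.
case: r IH le => [_|y r IH _]; last by rewrite IH ?orbT.
rewrite big_nil => le; have ->: [::] = fmonom_val x.
  exact: dlle_anti (dlle_nil _) le.
by rewrite -(inj_eq val_inj) eqxx.
Qed.

Lemma lead_max (F : fieldType) (f : {freealg F[n]}) (w : {fmonom 'I_n}) :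
  w \in msupp f -> dlle w (lead f).
Proof. exact: dlmax_seq_ge. Qed.

Lemma lead_supp (F : fieldType) (f : {freealg F[n]}) :
  f != 0 -> FMonom (lead f) \in msupp f.
Proof.
move=> nz; apply: dlmax_seq_mem; apply: contra nz => /eqP e.
rewrite -msupp_eq0; apply/eqP/fsetP => w.
by rewrite in_fset0; move: (in_nil w); rewrite -e.
Qed.

End DegLexFacts.

(* [None] encodes an infinite entry. *)
Definition coxeter_matrix (n : nat) (m : 'M[option nat]_n) : Prop :=
  [/\ forall i j, m i j = m j i,
      forall i, m i i = Some 1%N
    & forall i j q, i != j -> m i j = Some q -> (2 <= q)%N].

Definition alt (T : Type) (a b : T) (l : nat) : seq T :=
  mkseq (fun i => if odd i then b else a) l.

Section Relations.
Variables (F : fieldType) (n : nat) (m : 'M[option nat]_n).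

(* [malt t a b] is (m - t)(a, b); it is only meant for m a b finite. *)
Definition malt (t : nat) (a b : 'I_n) : seq 'I_n :=
  alt a b (odflt 0%N (m a b) - t)%N.

Definition rel1 (a : 'I_n) : {freealg F[n]} := word F [:: a; a] - 1.

Definition rel2 (a b : 'I_n) : {freealg F[n]} :=
  word F (malt 0 a b) - word F (malt 0 b a).

(* The data s_j, s'_j (0 <= j <= k+1) are given by functions on nat, of which
   only the values at j <= k+1 matter. *)
Variables (k : nat) (s s' : nat -> 'I_n).

Definition blk (j : nat) : seq 'I_n := malt 1 (s j) (s' j).

(* The product u_p u_(p+1) ... u_(q-1). *)
Definition blks (p q : nat) : seq 'I_n := flatten [seq blk j | j <- index_iota p q].

(* Both words are nonempty for the data of [chain_data], so the default letter
   of [last] plays no role. *)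
Definition xlast (j : nat) : 'I_n := last (s j) (blk j).
Definition ylast (j : nat) : 'I_n := last (s j) (malt 0 (s j) (s' j)).

Definition chain_data : Prop :=
  [/\ forall j, (j <= k.+1)%N -> m (s j) (s' j) != None,
      forall j, (j <= k)%N ->
        s' j.+1 = if odd (odflt 0%N (m (s j) (s' j))) then s j else s' j,
      (s' 0%N < s 0%N)%N,
      forall j, (1 <= j <= k.+1)%N -> (s j < s' j)%N
    & forall j, (j <= k)%N -> [set s j; s' j] != [set s j.+1; s' j.+1]].

Definition rel3 : {freealg F[n]} :=
  word F (blks 0 k.+1 ++ malt 0 (s k.+1) (s' k.+1))
  - word F (malt 0 (s' 0%N) (s 0%N) ++ blks 1 k.+2).

End Relations.

Inductive coxS (F : fieldType) (n : nat) (m : 'M[option nat]_n) :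
    {freealg F[n]} -> Prop :=
| CoxS1 (a : 'I_n) : coxS m (rel1 F a)
| CoxS2 (a b : 'I_n) of (b < a)%N & m a b != None : coxS m (rel2 F m a b)
| CoxS3 (k : nat) (s s' : nat -> 'I_n) of chain_data m k s s' :
    coxS m (rel3 F m k s s').

Definition congr_mod (F : fieldType) (n : nat) (S : {freealg F[n]} -> Prop)
    (w : seq 'I_n) (h h' : {freealg F[n]}) : Prop :=
  exists (N : nat) (alpha : 'I_N -> F) (a b : 'I_N -> seq 'I_n)
         (g : 'I_N -> {freealg F[n]}),
    (forall r, S (g r) /\ dllt (a r ++ lead (g r) ++ b r) w) /\
    h - h' = \sum_(r < N) alpha r *: (word F (a r) * g r * word F (b r)).

Definition inclusion_comp (F : fieldType) (n : nat) (f g : {freealg F[n]})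
    (a b : seq 'I_n) : {freealg F[n]} :=
  f - word F a * g * word F b.

(* Main.v *)
Require Import Defs.
From mathcomp Require Import all_boot all_order all_algebra.
From mathcomp Require Import finmap.
From mathcomp.multinomials Require Import monalg.
From mathcomp Require Import zify.

(** The occurrence of the braid word [m(t, t')] in the leading word of [f]
    covers the last letter [x] of [u_i], all of [u_(i+1)] and the first letter
    of [u_(i+2)].  The second letter of [u_(i+1)], if there were one, would be
    the last letter [y] of [m(s_i, s'_i)] and would sit where [m(t, t')] has
    another [x]; as [x] and [y] differ, [u_(i+1)] is a single letter [p] and the
    occurrence is [x p x] ([overlap_shape]).  Thus [p] commutes with [y], [x p]
    has order 3, and [p < x < y] by the inequalities of the chain.

    The composition is therefore the difference of the word with [p x p] in
    place of [x p x] and of the second word [s'_0 u_0 ... u_(k+1)] of [f].  When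
    [u_i] is long, a [y] precedes the occurrence and one commutation [y p = p y]
    gives the claim ([commute_overlap]).

    When [u_i] has one letter, [x] commutes with [y] too, so replacing
    [(x, p, x)] by [(p, x, p)] in the data produces another sequence along which
    the letter [y] can be carried ([overlap_commuting]).  Its leading word is
    the smaller word just obtained, the relation (3') rewrites it, and a last
    braid move turns [p x p] back into [x p x].  The new data may violate the
    requirement that consecutive pairs be distinct; then the two
    blocks concerned are mutually inverse, and everything happens among strictly
    shorter words, where square and braid moves are unrestricted
    ([rel3_congr]).

    When [u_i] has two letters, [s'_i < s_i], which happens only for [i = 0];
    then [p, x, y] generate a group of type A_3 and an explicit sequence of
    braid moves connects the two words ([overlap_order3]). *)

Set Implicit Arguments.
Unset Strict Implicit.
Unset Printing Implicit Defensive.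

Import Order.TTheory GRing.Theory.
Local Open Scope ring_scope.

(** * The deg-lex order *)

Section DegLexOrder.
Variable n : nat.
Implicit Types (u v w : seq 'I_n) (c d : 'I_n).

Lemma dllt_trans v u w : dllt u v -> dllt v w -> dllt u w.
Proof.
move=> /andP[nuv uv] /andP[nvw vw]; apply/andP; split; last first.
  exact: dlle_trans uv vw.
by apply: contra nuv => /eqP e; rewrite -e in vw; rewrite (dlle_anti uv vw).
Qed.

Lemma size_dllt u v : (size u < size v)%N -> dllt u v.
Proof.
move=> h; rewrite /dllt /dlle h andbT.
by apply: contraTneq h => ->; rewrite ltnn.
Qed.

Lemma dllt_first a c d u v :
  (c < d)%N -> size u = size v -> dllt (a ++ c :: u) (a ++ d :: v).
Proof.
move=> cd uv; rewrite /dllt /dlle !size_cat /= uv eqxx ltnn /=.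
rewrite eqseq_cat // eqxx eqseq_cons -val_eqE /= (ltn_eqF cd) /=.
elim: a => [|z a IH] /=; last by rewrite lexi_cons lexx.
by rewrite lexi_cons !leEord /= (ltnW cd) leqNgt cd.
Qed.

End DegLexOrder.

(** * Congruence modulo a set of polynomials below a word *)

Section Differences.
Variable V : zmodType.
Implicit Types x y z : V.

Lemma subrBB x y z : x - z - (x - y) = y - z.
Proof. by rewrite opprB addrC addrA subrK. Qed.

Lemma addrKBB x y z : x - z - (y - z) = x - y.
Proof. by rewrite opprB addrA subrK. Qed.

End Differences.

Section Congruence.
Variables (F : fieldType) (n : nat).
Implicit Types (u v w a b : seq 'I_n) (S : {freealg F[n]} -> Prop).

Lemma word_cat u v : word F (u ++ v) = word F u * word F v.
Proof.
rewrite malgM_def /word fgmulUU mulr1; congr (<< _ *g _ >>).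
by apply: val_inj; rewrite /= fmM.
Qed.

Lemma word_nil : word F ([::] : seq 'I_n) = 1.
Proof.
apply/malgP => z; rewrite mcoeff1 /word mcoeffU eq_sym; congr ((_ == _)%:R).
by apply: val_inj; rewrite /= fm1.
Qed.

Lemma word_subM a u v b :
  word F a * (word F u - word F v) * word F b
  = word F (a ++ u ++ b) - word F (a ++ v ++ b).
Proof.
have -> : word F a * (word F u - word F v) = word F (a ++ u) - word F (a ++ v).
  by rewrite mulrBr -!word_cat.
by rewrite mulrBl -!word_cat -!catA.
Qed.

Lemma lead_sub_words u v : dllt v u -> lead (word F u - word F v) = u.
Proof.
move=> /andP[nvu vu].
have nuv : (FMonom u == FMonom v) = false.
  by apply/negbTE; rewrite eq_sym -(inj_eq val_inj).
have cu : (word F u - word F v)@_(FMonom u) = 1.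
  by rewrite mcoeffB /word !mcoeffU eqxx eq_sym nuv subr0.
have uS : FMonom u \in msupp (word F u - word F v).
  by rewrite -mcoeff_neq0 cu oner_eq0.
have nz : word F u - word F v != 0.
  by apply: contraTneq uS => ->; rewrite msupp0 in_fset0.
move: (lead_supp nz) (lead_max uS); move: (lead _) => L.
rewrite -mcoeff_neq0 mcoeffB /word !mcoeffU /= => LS uL.
case: (FMonom u =P FMonom L) LS => [[]//|_].
case: (FMonom v =P FMonom L) => [[e] _|_]; last by rewrite subr0 eqxx.
by rewrite -e in uL *; rewrite (dlle_anti uL vu).
Qed.

Lemma congr_mod_refl S w h : congr_mod S w h h.
Proof.
exists 0%N, (fun _ => 0), (fun _ => [::]), (fun _ => [::]), (fun _ => 0).
by split; [case | rewrite big_ord0 subrr].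
Qed.

Lemma congr_mod_sym S w h h' : congr_mod S w h h' -> congr_mod S w h' h.
Proof.
move=> [N [al [a [b [g [Sg e]]]]]]; exists N, (fun r => - al r), a, b, g.
split; first exact: Sg.
have -> : h' - h = - (h - h') by rewrite opprB.
rewrite e -sumrN.
by apply: eq_bigr => r _; rewrite scaleNr.
Qed.

Lemma congr_mod_trans S w h2 h1 h3 :
  congr_mod S w h1 h2 -> congr_mod S w h2 h3 -> congr_mod S w h1 h3.
Proof.
move=> [N [al [a [b [g [Sg e]]]]]] [N' [al' [a' [b' [g' [Sg' e']]]]]].
pose pk T (x : 'I_N -> T) (x' : 'I_N' -> T) (r : 'I_(N + N')) :=
  match split r with inl j => x j | inr j => x' j end.
exists (N + N')%N, (pk _ al al'), (pk _ a a'), (pk _ b b'), (pk _ g g').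
split; first by move=> r; rewrite /pk; case: (split r).
have -> : h1 - h3 = (h1 - h2) + (h2 - h3) by rewrite addrA subrK.
rewrite e e' big_split_ord; apply: f_equal2.
  by apply: eq_bigr => r _; rewrite /pk (unsplitK (inl r)).
by apply: eq_bigr => r _; rewrite /pk (unsplitK (inr r)).
Qed.

Lemma congr_mod_null S w h p r :
  h = p - r -> congr_mod S w p r -> congr_mod S w h 0.
Proof. by rewrite /congr_mod => ->; rewrite subr0. Qed.

Lemma congr_mod_subr S w h p q r :
  h = p - r -> congr_mod S w p q -> congr_mod S w h (q - r).
Proof. by rewrite /congr_mod => ->; rewrite addrKBB. Qed.

(** One multiple of an element of [S] is the only source of congruences used
    below; everything else is transitivity. *)
Lemma congr_mod_gen S w a b g h h' :
  S g -> dllt (a ++ lead g ++ b) w -> h - h' = word F a * g * word F b ->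
  congr_mod S w h h'.
Proof.
move=> Sg lt e; exists 1%N, (fun _ => 1), (fun _ => a), (fun _ => b), (fun _ => g).
by split=> //; rewrite big_ord1 scale1r.
Qed.

End Congruence.

(** * Alternating words *)

Section Alternating.
Variable T : Type.
Implicit Types a b : T.

Lemma cat_injl u : injective (cat u : seq T -> seq T).
Proof. by elim: u => [//|x u IH] v1 v2 /= [/IH]. Qed.

Lemma cat_injr (v : seq T) : injective (cat^~ v).
Proof.
move=> u1 u2 /(congr1 rev); rewrite !rev_cat => /cat_injl.
exact: can_inj revK _ _.
Qed.

Lemma altS a b l : alt a b l.+1 = a :: alt b a l.
Proof.
rewrite /alt /mkseq /=; congr (_ :: _); rewrite (iotaDl 1 0) -map_comp.
by apply: eq_map => j /=; case: (odd j).
Qed.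

Lemma alt_rcons a b l :
  alt a b l.+1 = rcons (alt a b l) (if odd l then b else a).
Proof. by rewrite /alt /mkseq -addn1 iotaD map_cat /= cats1. Qed.

Lemma size_alt a b l : size (alt a b l) = l.
Proof. by rewrite size_mkseq. Qed.

Lemma rev_alt a b l :
  rev (alt a b l) = if odd l then alt a b l else alt b a l.
Proof.
elim: l a b => [|l IH] a b //.
rewrite {1}alt_rcons rev_rcons IH oddS.
by case: (odd l); rewrite !altS.
Qed.

End Alternating.

(** * Square and braid moves below a word *)

Section CoxeterMoves.
Variables (F : fieldType) (n : nat) (m : 'M[option nat]_n) (w : seq 'I_n).
Hypothesis mC : coxeter_matrix m.

Local Notation "u ~ v" := (congr_mod (coxS m) w (word F u) (word F v))
  (at level 70).
Implicit Types (u v a b : seq 'I_n) (c d : 'I_n).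

Lemma order_ge2 c d :
  c != d -> m c d != None -> exists l, m c d = Some l.+2.
Proof.
case: mC => _ _ mge cd; case E: (m c d) => [[|[|l]]|] // _.
- by have := mge _ _ _ cd E.
- by have := mge _ _ _ cd E.
by exists l.
Qed.

Lemma rel1E c : rel1 F c = word F [:: c; c] - word F [::].
Proof. by rewrite /rel1 -(word_nil F n). Qed.

Lemma square_move a b c :
  dllt (a ++ [:: c; c] ++ b) w -> a ++ [:: c; c] ++ b ~ a ++ b.
Proof.
have lr : lead (rel1 F c) = [:: c; c].
  by rewrite rel1E lead_sub_words // size_dllt.
move=> lt; apply: (@congr_mod_gen _ _ _ _ a b (rel1 F c)).
- exact: CoxS1.
- by rewrite lr.
by rewrite rel1E word_subM.
Qed.

(** [rel2] is available only for [d < c]; since both words are required to lie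
    below [w], the move may be read in either direction. *)
Lemma braid_move a b c d :
  m c d != None ->
  dllt (a ++ malt m 0 c d ++ b) w -> dllt (a ++ malt m 0 d c ++ b) w ->
  a ++ malt m 0 c d ++ b ~ a ++ malt m 0 d c ++ b.
Proof.
wlog dc : c d / (d < c)%N => [hw fin lt lt'|].
  case: (ltngtP c d) => [cd|dc|e]; last by rewrite (val_inj e); exact: congr_mod_refl.
    by apply/congr_mod_sym/hw => //; case: mC => <-.
  exact: hw.
move=> fin lt lt'; apply: (@congr_mod_gen _ _ _ _ a b (rel2 F m c d)).
- exact: CoxS2.
- rewrite /rel2 lead_sub_words //.
  have cd : c != d by rewrite -val_eqE /= neq_ltn dc orbT.
  have [l e] := order_ge2 cd fin.
  have e' : m d c = Some l.+2 by case: mC => <-.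
  rewrite /malt e e' subn0 !(altS _ _ l.+1).
  by apply: (@dllt_first _ [::] d c (alt c d l.+1) (alt d c l.+1)) => //;
    rewrite !size_alt.
by rewrite word_subM.
Qed.

(** A word followed by its reverse collapses from the middle, two letters at a
    time; the words only get shorter, so the first bound suffices. *)
Lemma cancel_rev u a b :
  dllt (a ++ u ++ rev u ++ b) w -> a ++ u ++ rev u ++ b ~ a ++ b.
Proof.
elim/last_ind: u b => [|u c IH] b; first by move=> _; exact: congr_mod_refl.
rewrite rev_rcons -cats1 -!catA /= => lt.
apply: (@congr_mod_trans _ _ _ _ (word F (a ++ u ++ rev u ++ b))).
  have := @square_move (a ++ u) (rev u ++ b) c.
  by rewrite -!catA; apply.
apply: IH; apply: dllt_trans lt; apply: size_dllt.
by rewrite !size_cat /= !size_cat !ltn_add2l ltnS leqnSn.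
Qed.

(** The conditions of [chain_data] except that consecutive pairs be distinct:
    the requirement that is lost when the data are modified in
    [overlap_commuting]. *)
Definition linked k (s s' : nat -> 'I_n) : Prop :=
  [/\ forall j, (j <= k.+1)%N -> m (s j) (s' j) != None,
      forall j, (j <= k)%N ->
        s' j.+1 = if odd (odflt 0%N (m (s j) (s' j))) then s j else s' j,
      (s' 0%N < s 0%N)%N
    & forall j, (1 <= j <= k.+1)%N -> (s j < s' j)%N].

(** * Chains of alternating blocks *)

Section Chain.
Variables (s s' : nat -> 'I_n).
Local Notation blk := (blk m s s').
Local Notation blks := (blks m s s').
Local Notation ylast := (ylast m s s').

(** The letter that arrives in front of the block [u_j] when the last letter of
    [m(s_(k+1), s'_(k+1))] travels leftwards.  It equals [s'_j] wherever [s'_j]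
    is part of the data ([carriedE]), but it also makes sense just after the
    last block. *)
Definition carried j : 'I_n := if j is j'.+1 then ylast j' else s' 0%N.

Lemma blks_cat p r q : (p <= r <= q)%N -> blks p q = blks p r ++ blks r q.
Proof.
case/andP=> pr rq; rewrite /Defs.blks -flatten_cat -map_cat; congr (flatten (map _ _)).
rewrite /index_iota (_ : (q - p = (r - p) + (q - r))%N) ?iotaD ?subnKC //.
by rewrite addnC addnBA // subnK.
Qed.

Lemma blksS p q : (p <= q)%N -> blks p q.+1 = blks p q ++ blk q.
Proof.
move=> pq; rewrite (@blks_cat p q) ?pq ?leqnSn //; congr (_ ++ _).
by rewrite /Defs.blks /index_iota subSnn /= cats0.
Qed.

Lemma blks_first p q : (p < q)%N -> blks p q = blk p ++ blks p.+1 q.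
Proof. by move=> pq; rewrite /Defs.blks /index_iota -(subnSK pq). Qed.

Lemma blkE j l : m (s j) (s' j) = Some l.+1 -> blk j = alt (s j) (s' j) l.
Proof. by move=> e; rewrite /Defs.blk /malt e subn1. Qed.

Lemma ylastE j l : m (s j) (s' j) = Some l.+1 ->
  ylast j = if odd l then s' j else s j.
Proof. by move=> e; rewrite /Defs.ylast /malt e subn0 alt_rcons last_rcons. Qed.

Lemma blk_ylast j l : m (s j) (s' j) = Some l.+1 ->
  blk j ++ [:: ylast j] = malt m 0 (s j) (s' j).
Proof.
by move=> e; rewrite (blkE e) (ylastE e) /malt e subn0 alt_rcons cats1.
Qed.

Lemma first_blk j l : m (s j) (s' j) = Some l.+1 ->
  s' j :: blk j = malt m 0 (s' j) (s j).
Proof.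
move=> e; rewrite (blkE e) /malt (_ : m (s' j) (s j) = Some l.+1).
  by rewrite subn0 altS.
by case: mC => <-.
Qed.

(** Each block is crossed by one braid move, [u_j y_j = s'_j u_j].  All
    intermediate words have the same length, hence the bound on all words of
    that length placed between [a] and [b]. *)
Lemma carry p q a b :
  (p <= q)%N ->
  (forall j, (p <= j < q)%N ->
     s j != s' j /\ m (s j) (s' j) != None /\ s' j = carried j) ->
  (forall v, size v = (size (blks p q)).+1 -> dllt (a ++ v ++ b) w) ->
  a ++ blks p q ++ carried q :: b ~ a ++ carried p :: blks p q ++ b.
Proof.
elim: q b => [|q IH] b.
  rewrite leqn0 => /eqP -> _ _; rewrite /Defs.blks /=; exact: congr_mod_refl.
rewrite leq_eqVlt => /orP[/eqP <- _ _|pq hch lt].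
  by rewrite /Defs.blks /index_iota subnn; exact: congr_mod_refl.
rewrite ltnS in pq.
have [nss [fin cq]] : s q != s' q /\ m (s q) (s' q) != None /\ s' q = carried q.
  by apply: hch; rewrite pq ltnSn.
have [l e] := order_ge2 nss fin.
move: lt; rewrite blksS // => lt.
apply: (@congr_mod_trans _ _ _ _ (word F (a ++ blks p q ++ carried q :: blk q ++ b))).
  rewrite -cq -catA; have := @braid_move (a ++ blks p q) b _ _ fin.
  rewrite -(first_blk e) -(blk_ylast e) -!catA /=; apply.
    have := lt (blks p q ++ blk q ++ [:: ylast q]).
    by rewrite !size_cat -!catA addnA addn1; apply.
  have := lt (blks p q ++ s' q :: blk q).
  by rewrite !size_cat -!catA /= addnS; apply.
rewrite -catA; apply: IH => // [j /andP[pj jq]|v sv].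
  by apply: hch; rewrite pj ltnS ltnW.
by have := lt (v ++ blk q); rewrite -catA; apply; rewrite !size_cat sv addSn.
Qed.

(** If two consecutive pairs coincide, [u_(j+1)] starts with the last letter of
    [u_j] and alternates back through the same letters. *)
Lemma blk_rev j l :
  m (s j) (s' j) = Some l.+1 -> s j.+1 != s' j.+1 -> s' j.+1 = ylast j ->
  [set s j; s' j] = [set s j.+1; s' j.+1] ->
  blk j.+1 = rev (blk j) /\ ylast j.+1 = s' j.
Proof.
move=> e ns e' es; case: (mC) => msym _ _.
have := set21 (s j.+1) (s' j.+1); rewrite -es => /set2P.
rewrite e' (ylastE e) in ns es *.
have e1 : s j.+1 = (if odd l then s j else s' j) ->
    m (s j.+1) (s' j.+1) = Some l.+1.
  by move=> ->; rewrite e' (ylastE e); case: (odd l); rewrite // msym.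
case ol: (odd l) ns e1 => ns e1 [ej|ej].
- have ee := e1 ej; rewrite (blkE e) (blkE ee) (ylastE ee) rev_alt ol.
  by rewrite ej e' (ylastE e) ol.
- by rewrite ej eqxx in ns.
- by rewrite ej eqxx in ns.
have ee := e1 ej; rewrite (blkE e) (blkE ee) (ylastE ee) rev_alt ol.
by rewrite ej e' (ylastE e) ol.
Qed.

(** * The relations (3') and their overlaps with braid words *)

Section Relation3.
Variable k : nat.
Hypothesis ch : linked k s s'.

Lemma chain_finite j : (j <= k.+1)%N -> m (s j) (s' j) != None.
Proof. by case: ch => h _ _ _; exact: h. Qed.

Lemma chain_link j : (j <= k)%N ->
  s' j.+1 = if odd (odflt 0%N (m (s j) (s' j))) then s j else s' j.
Proof. by case: ch => _ h _ _; exact: h. Qed.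

Lemma chain_start : (s' 0%N < s 0%N)%N.
Proof. by case: ch. Qed.

Lemma chain_ascent j : (1 <= j <= k.+1)%N -> (s j < s' j)%N.
Proof. by case: ch => _ _ _ h; exact: h. Qed.

Lemma chain_neq j : (j <= k.+1)%N -> s j != s' j.
Proof.
rewrite -val_eqE /= neq_ltn; case: j => [|j] jk; first by rewrite chain_start orbT.
by rewrite chain_ascent.
Qed.

Lemma chain_order j :
  (j <= k.+1)%N -> exists l, m (s j) (s' j) = Some l.+2.
Proof. by move=> jk; apply: order_ge2; [exact: chain_neq | exact: chain_finite]. Qed.

Lemma carriedE j : (j <= k.+1)%N -> s' j = carried j.
Proof.
case: j => [//|j] jk; have [l e] := chain_order (ltnW jk).
by rewrite chain_link // e /= negbK (ylastE e) /=; case: (odd l).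
Qed.

Lemma rel3E :
  rel3 F m k s s' =
  word F (blks 0 k.+2 ++ [:: ylast k.+1]) - word F (s' 0%N :: blks 0 k.+2).
Proof.
have [l e] := chain_order (leqnn _); have [l0 e0] := chain_order (leq0n _).
have -> : blks 0 k.+2 ++ [:: ylast k.+1]
    = blks 0 k.+1 ++ malt m 0 (s k.+1) (s' k.+1).
  by rewrite blksS // -catA (blk_ylast e).
have -> : s' 0%N :: blks 0 k.+2 = malt m 0 (s' 0%N) (s 0%N) ++ blks 1 k.+2.
  by rewrite (@blks_first 0) // -(first_blk e0).
by [].
Qed.

Lemma lt_start c v : (c < s 0%N)%N -> size v = size (blks 0 k.+2) ->
  dllt (c :: v) (blks 0 k.+2 ++ [:: ylast k.+1]).
Proof.
have [l e] := chain_order (leq0n _).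
rewrite (@blks_first 0) // (blkE e) altS => lt0 sz.
apply: (@dllt_first _ [::] _ _ _ (_ ++ _)) => //=.
by rewrite sz /= !size_cat /= addn1.
Qed.

Lemma rel3_words_lt :
  dllt (s' 0%N :: blks 0 k.+2) (blks 0 k.+2 ++ [:: ylast k.+1]).
Proof. exact: lt_start chain_start _. Qed.

Lemma lead_rel3 : lead (rel3 F m k s s') = blks 0 k.+2 ++ [:: ylast k.+1].
Proof. by rewrite rel3E lead_sub_words // rel3_words_lt. Qed.

(** Where the pairs [j] and [j+1] coincide, (3') is not available, but
    [u_j u_(j+1)] cancels.  In the shorter word the last letter is carried to
    the front, passing from block [j+2] directly to block [j-1] because
    [y_(j+1) = s'_j], and the two blocks are then put back. *)
Lemma rel3_congr :
  dllt (blks 0 k.+2 ++ [:: ylast k.+1]) w ->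
  blks 0 k.+2 ++ [:: ylast k.+1] ~ s' 0%N :: blks 0 k.+2.
Proof.
move=> lt.
case: (boolP [forall j : 'I_k.+1,
    [set s j; s' j] != [set s j.+1; s' j.+1]]) => [/forallP d|].
  apply: (@congr_mod_gen _ _ _ _ [::] [::] (rel3 F m k s s')).
  - apply: CoxS3; case: ch => *; split=> // j jk.
    exact: (d (Ordinal (jk : j < k.+1)%N)).
  - by rewrite lead_rel3 cats0.
  by rewrite word_nil mul1r mulr1 rel3E.
rewrite negb_forall => /existsP[[j jk]] /=; rewrite negbK => /eqP es.
have [l e] := chain_order (ltnW jk).
have [rv yj] := blk_rev e (chain_neq jk) (carriedE jk) es.
have cut : blks 0 k.+2 = blks 0 j ++ blk j ++ rev (blk j) ++ blks j.+2 k.+2.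
  have jk2 : (j < k.+2)%N by rewrite ltnS ltnW.
  rewrite (@blks_cat 0 j k.+2); last by rewrite leq0n ltnW.
  by rewrite (@blks_first j k.+2) // (@blks_first j.+1 k.+2) // rv.
have lt' := dllt_trans rel3_words_lt lt.
move: lt lt'; rewrite cut -!catA => lt lt'.
have szb : (0 < size (blk j))%N by rewrite (blkE e) size_alt.
apply: (congr_mod_trans (cancel_rev lt)).
apply: (@congr_mod_trans _ _ _ _ (word F (s' 0%N :: blks 0 j ++ blks j.+2 k.+2)));
  last exact/congr_mod_sym/(@cancel_rev (blk j) (s' 0%N :: blks 0 j)).
have short a v b :
    size (a ++ v ++ b) = (size (blks 0 j) + size (blks j.+2 k.+2)).+1 ->
    dllt (a ++ v ++ b) w.
  move=> sz; apply: dllt_trans lt; apply: size_dllt.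
  rewrite sz !size_cat size_rev /= addn1 !addnS ltnS ltn_add2l.
  by rewrite -[X in (X < _)%N]add0n addnA ltn_add2r addn_gt0 szb.
have okj i : (i <= k.+1)%N ->
    s i != s' i /\ m (s i) (s' i) != None /\ s' i = carried i.
  by move=> ik; split; [exact: chain_neq | split; [exact: chain_finite | exact: carriedE]].
apply: (@congr_mod_trans _ _ _ _
  (word F (blks 0 j ++ carried j.+2 :: blks j.+2 k.+2))).
  rewrite -[X in carried _ :: X]cats0.
  apply: (@carry j.+2 k.+2 (blks 0 j) [::]) => // [i /andP[_ ik]|v sv].
    exact: okj.
  by apply: short; rewrite !size_cat sv addn0 addnS.
have -> : carried j.+2 = carried j by rewrite /= yj carriedE // ltnW.
apply: (@carry 0 j [::]) => // [i /andP[_ ij]|v sv].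
  by apply: okj; apply: leq_trans (ltnW ij) (ltnW jk).
by apply: short; rewrite /= size_cat sv addSn.
Qed.

Lemma blk_rcons_xlast j : (j <= k.+1)%N ->
  blk j = malt m 2 (s j) (s' j) ++ [:: xlast m s s' j].
Proof.
move=> jk; have [l e] := chain_order jk.
by rewrite /xlast (blkE e) /malt e alt_rcons last_rcons cats1 !subSS subn0.
Qed.

Lemma blk_first j : (j <= k.+1)%N -> blk j = s j :: malt m 2 (s' j) (s j).
Proof.
move=> jk; have [l e] := chain_order jk.
have e' : m (s' j) (s j) = Some l.+2 by case: mC => <-.
by rewrite (blkE e) altS /malt e' !subSS subn0.
Qed.

(** These two letters are [s_j] and [s'_j] in some order. *)
Lemma xlast_neq j : (j <= k.+1)%N -> xlast m s s' j != ylast j.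
Proof.
move=> jk; have [l e] := chain_order jk.
rewrite /xlast (blkE e) (ylastE e) alt_rcons last_rcons /=.
by case: (odd l); rewrite /= ?[s' j == _]eq_sym chain_neq.
Qed.

(** After cancelling what surrounds the occurrence, the hypothesis reads
    [x u_(i+1) s_(i+2) = m(t, t')].  A second letter of [u_(i+1)] would be
    [s'_(i+1)], the last letter of [m(s_i, s'_i)], but its position in the
    alternating word forces it to be [x]. *)
Lemma overlap_shape (t t' : 'I_n) i (x := xlast m s s' i) :
  (t' < t)%N -> m t t' != None -> (i < k)%N ->
  lead (rel3 F m k s s') =
    (blks 0 i ++ malt m 2 (s i) (s' i)) ++ lead (rel2 F m t t')
      ++ malt m 2 (s' i.+2) (s i.+2) ++ blks i.+3 k.+2 ++ [:: ylast k.+1] ->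
  [/\ t = x, t' = s i.+1, m x (s i.+1) = Some 3%N
    & [/\ m (s i.+1) (s' i.+1) = Some 2%N, s i.+2 = x & s' i.+2 = s' i.+1]].
Proof.
move=> tt fin_t ik.
have i1k : (i.+1 <= k.+1)%N by rewrite ltnS ltnW.
have [l1 e1] := chain_order i1k.
have nt : t != t' by rewrite -val_eqE /= neq_ltn tt orbT.
have [q eq] := order_ge2 nt fin_t.
have -> : lead (rel2 F m t t') = alt t t' q.+2.
  have e' : m t' t = Some q.+2 by case: mC => <-.
  rewrite /rel2 lead_sub_words /malt ?eq ?e' ?subn0 //.
  rewrite !(altS _ _ q.+1).
  by apply: (@dllt_first _ [::] _ _ (alt t t' q.+1) (alt t' t q.+1)) => //;
    rewrite !size_alt.
rewrite lead_rel3 => eqw.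
have core : x :: blk i.+1 ++ [:: s i.+2] = alt t t' q.+2.
  move: eqw; rewrite (@blks_cat 0 i k.+2); last by lia.
  rewrite (@blks_first i); last by lia.
  rewrite (@blks_first i.+1); last by lia.
  rewrite (@blks_first i.+2) // blk_rcons_xlast; last by lia.
  rewrite (blk_first (j := i.+2)) // -!catA => /cat_injl/cat_injl.
  rewrite -cat1s -[s i.+2 :: _]cat1s !catA.
  by move=> /cat_injr/cat_injr/cat_injr <-; rewrite -catA.
move: core; rewrite (blkE e1) => core.
have sq : q = l1.+1 
  by move/(congr1 size): core; rewrite -cat1s !size_cat !size_alt /=; lia.
rewrite sq altS [alt t t' _]altS [alt t' t _]altS in core.
case: core => ex ep; rewrite -ex -ep in eq *.
case: l1 sq e1 => [|l1] sq e1; last first.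
  rewrite altS (altS x) cat_cons => -[e3 _].
  have : x != ylast i by apply: xlast_neq; lia.
  by rewrite -e3 (@carriedE i.+1) // eqxx.
rewrite !altS => -[e3]; split=> //; first by rewrite eq sq.
by split=> //; rewrite chain_link // e1.
Qed.

End Relation3.
End Chain.

(** The words stay below [w] because [x] has become [p] in the first one and
    [y] has become [p] in the second. *)
Lemma commute_overlap a b (p x y : 'I_n) :
  m p y = Some 2%N -> (p < x)%N -> (p < y)%N -> w = a ++ [:: y; x; p; x] ++ b ->
  a ++ [:: y; p; x; p] ++ b ~ a ++ [:: p; y; x; p] ++ b.
Proof.
move=> mpy px py ew; have myp : m y p = Some 2%N by case: mC => <-.
have := @braid_move a ([:: x; p] ++ b) y p; rewrite /malt mpy myp; apply=> //.
  have := @dllt_first _ (a ++ [:: y]) p x (x :: p :: b) (p :: x :: b).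
  by rewrite ew -!catA; apply.
by rewrite ew; apply: dllt_first.
Qed.

Lemma eq_blks s1 s2 s' p q :
  (forall j, (p <= j < q)%N -> s1 j = s2 j) -> blks m s1 s' p q = blks m s2 s' p q.
Proof.
move=> e; rewrite /blks; congr flatten; apply/eq_in_map => j.
by rewrite mem_index_iota /blk => /e ->.
Qed.

(** With [x = s_i], [p = s_(i+1)] and [y = s'_i], both [x] and [p] commute with
    [y], so exchanging the roles of [x] and [p] in the three blocks [x, p, x]
    leaves the letters carried along the chain unchanged.  Since [x < y],
    the index [i] is positive and the first pair is untouched, so that
    everything done after carrying [s'_0] to the front stays below [w]. *)
Lemma overlap_commuting k s s' i :
  linked k s s' -> (i < k)%N ->
  m (s i) (s' i) = Some 2%N -> m (s i.+1) (s' i.+1) = Some 2%N ->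
  s i.+2 = s i -> s' i.+2 = s' i.+1 ->
  m (s i) (s i.+1) = Some 3%N -> (s i.+1 < s i)%N ->
  w = blks m s s' 0 k.+2 ++ [:: ylast m s s' k.+1] ->
  blks m s s' 0 i ++ [:: s i.+1; s i; s i.+1]
    ++ blks m s s' i.+3 k.+2 ++ [:: ylast m s s' k.+1]
  ~ s' 0%N :: blks m s s' 0 k.+2.
Proof.
move=> ch ik mi mi1 e2 e2' m3 px ew.
have e1' : s' i.+1 = s' i by rewrite (chain_link ch) ?mi // ltnW.
have xy : (s i < s' i)%N by have := chain_ascent ch (j := i.+2); rewrite e2 e2' e1'; apply.
have i0 : (0 < i)%N.
  by case: (posnP i) (chain_start ch) => // <-; rewrite ltnNge ltnW.
pose s2 j := if j == i.+1 then s i else if (j == i) || (j == i.+2) then s i.+1 else s j.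
(* Wherever the new data differ from the old ones, both have order 2, which
   is all that the link conditions and the last letter depend on. *)
have s2P j : s2 j = s j \/ [/\ m (s j) (s' j) = Some 2%N,
     m (s2 j) (s' j) = Some 2%N, (s2 j < s' j)%N & j != 0%N].
  rewrite /s2; case: eqP => [->|_].
    by right; rewrite mi1 e1' mi xy.
  case: eqP => [->|_] /=.
    by right; rewrite -e1' mi1 e1' mi -lt0n i0 (ltn_trans px xy).
  case: eqP => [->|_]; last by left.
  by right; rewrite e2 e2' mi1 e1' mi (ltn_trans px xy).
have out j : (j < i)%N || (i.+2 < j)%N -> s2 j = s j.
  move=> h; rewrite /s2; case: eqP h => [->|_]; first by lia.
  by case: eqP => [->|_]; [lia|case: eqP => [->|//]; lia].
have ch2 : linked k s2 s'.
  case: (ch) => c1 c2 c3 c4; split.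
  - by move=> j jk; case: (s2P j) => [->|[_ -> _ _]] //; exact: c1.
  - move=> j jk; rewrite c2 //.
    by case: (s2P j) => [->|[-> -> _ _]].
  - by rewrite out ?i0.
  by move=> j jk; case: (s2P j) => [->|[]] //; exact: c4.
have yl : ylast m s2 s' k.+1 = ylast m s s' k.+1.
  case: (s2P k.+1) => [|[h1 h2 _ _]]; first by rewrite /ylast => ->.
  by rewrite (ylastE h1) (ylastE h2).
have bi : blk m s s' i = [:: s i] by rewrite (blkE mi).
have bi1 : blk m s s' i.+1 = [:: s i.+1] by rewrite (blkE mi1).
have bi2 : blk m s s' i.+2 = [:: s i].
  by rewrite (@blkE _ _ _ 1) ?e2 ?e2' ?e1'.
have s2i : s2 i = s i.+1 by rewrite /s2 eqxx ltn_eqF.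
have s2i1 : s2 i.+1 = s i by rewrite /s2 eqxx.
have s2i2 : s2 i.+2 = s i.+1 by rewrite /s2 eqxx orbT gtn_eqF.
have ci : blk m s2 s' i = [:: s i.+1].
  by rewrite (@blkE _ _ _ 1) s2i // -e1'.
have ci1 : blk m s2 s' i.+1 = [:: s i].
  by rewrite (@blkE _ _ _ 1) s2i1 // e1'.
have ci2 : blk m s2 s' i.+2 = [:: s i.+1].
  by rewrite (@blkE _ _ _ 1) s2i2 // e2'.
have dec : blks m s s' 0 k.+2 =
    blks m s s' 0 i ++ [:: s i; s i.+1; s i] ++ blks m s s' i.+3 k.+2.
  rewrite (@blks_cat s s' 0 i); last by lia.
  rewrite (@blks_first s s' i); last by lia.
  rewrite (@blks_first s s' i.+1); last by lia.
  by rewrite (@blks_first s s' i.+2) // bi bi1 bi2.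
have dec2 : blks m s2 s' 0 k.+2 =
    blks m s s' 0 i ++ [:: s i.+1; s i; s i.+1] ++ blks m s s' i.+3 k.+2.
  rewrite (@blks_cat s2 s' 0 i); last by lia.
  rewrite (@blks_first s2 s' i); last by lia.
  rewrite (@blks_first s2 s' i.+1); last by lia.
  rewrite (@blks_first s2 s' i.+2) // ci ci1 ci2 /=.
  by congr (_ ++ [:: _, _, _ & _]); apply: eq_blks => j jk; apply: out; lia.
have st v : size v = size (blks m s s' 0 k.+2) -> dllt (s' 0%N :: v) w.
  by move=> sz; rewrite ew; apply: lt_start ch _ _ (chain_start ch) sz.
apply: (@congr_mod_trans _ _ _ _ (word F (s' 0%N :: blks m s2 s' 0 k.+2))).
  have := @rel3_congr s2 s' k ch2; rewrite yl dec2 -!catA; apply.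
  by rewrite ew dec -!catA /=; apply: dllt_first.
(* The words now start with s'_0, so the braid can be undone. *)
have m3' : m (s i.+1) (s i) = Some 3%N by case: mC => <-.
have := @braid_move (s' 0%N :: blks m s s' 0 i) (blks m s s' i.+3 k.+2)
  (s i.+1) (s i).
rewrite dec2 dec /malt m3 m3'; apply=> //=;
  by apply: st; rewrite dec !size_cat.
Qed.

(** With [y = s_0], [x = s'_0] and [p = s_1], these letters satisfy the braid
    relations of the path [p - x - y].  The word [w] starts with [y x], the
    largest letter followed by [x > p], so every word of the same length
    starting with [p], with [x] or with [y p] lies below it.  Braid moves give
    [y p x p y = p x y x p]; the last letter of the word is then carried to the
    front of [u_3], where it becomes [x], and [p x y x p x = x y x p x y] holds
    in the symmetric group with these generators. *)
Lemma overlap_order3 k s s' :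
  linked k s s' -> (0 < k)%N ->
  m (s 0%N) (s' 0%N) = Some 3%N -> m (s 1%N) (s' 1%N) = Some 2%N ->
  s 2%N = s' 0%N -> s' 2%N = s' 1%N ->
  m (s' 0%N) (s 1%N) = Some 3%N -> (s 1%N < s' 0%N)%N ->
  w = blks m s s' 0 k.+2 ++ [:: ylast m s s' k.+1] ->
  [:: s 0%N; s 1%N; s' 0%N; s 1%N; s 0%N]
    ++ blks m s s' 3 k.+2 ++ [:: ylast m s s' k.+1]
  ~ s' 0%N :: blks m s s' 0 k.+2.
Proof.
move=> ch k0 m0 m1 e2 e2' m3 px ew.
have e1' : s' 1%N = s 0%N by rewrite (chain_link ch) ?m0.
have xy := chain_start ch.
have b0 := blkE m0; have b1 := blkE m1.
have m2 : m (s 2%N) (s' 2%N) = Some 3%N by rewrite e2 e2' e1'; case: mC => <-.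
have b2 := blkE m2.
have c3 : carried s s' 3 = s' 0%N by rewrite /= (ylastE m2) e2.
have dec : blks m s s' 0 k.+2 =
    [:: s 0%N; s' 0%N; s 1%N; s' 0%N; s 0%N] ++ blks m s s' 3 k.+2.
  rewrite (@blks_first s s' 0) // (@blks_first s s' 1) //.
  by rewrite (@blks_first s s' 2) // b0 b1 b2 e2 e2' e1'.
have st c v : (c < s 0%N)%N -> size v = size (blks m s s' 0 k.+2) ->
    dllt (c :: v) w by move=> h sz; rewrite ew; apply: lt_start ch _ _ h sz.
have st2 v : (size v).+1 = size (blks m s s' 0 k.+2) ->
    dllt (s 0%N :: s 1%N :: v) w.
  rewrite ew dec => -[sz]; apply: (@dllt_first _ [:: s 0%N]) => //=.
  by rewrite sz size_cat addn1.
set x := s' 0%N; set y := s 0%N; set p := s 1%N.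
set U := blks m s s' 3 k.+2; set R := U ++ [:: ylast m s s' k.+1].
have py a b : dllt (a ++ [:: p; y] ++ b) w -> dllt (a ++ [:: y; p] ++ b) w ->
    a ++ [:: p; y] ++ b ~ a ++ [:: y; p] ++ b.
  have e : m p y = Some 2%N by rewrite -m1 e1'.
  have e' : m y p = Some 2%N by case: mC => <-.
  by have := @braid_move a b p y; rewrite /malt e e'; apply.
have pxp a b : dllt (a ++ [:: p; x; p] ++ b) w -> dllt (a ++ [:: x; p; x] ++ b) w ->
    a ++ [:: p; x; p] ++ b ~ a ++ [:: x; p; x] ++ b.
  have e : m p x = Some 3%N by case: mC => <-.
  by have := @braid_move a b p x; rewrite /malt e m3; apply.
have xyx a b : dllt (a ++ [:: x; y; x] ++ b) w -> dllt (a ++ [:: y; x; y] ++ b) w ->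
    a ++ [:: x; y; x] ++ b ~ a ++ [:: y; x; y] ++ b.
  have e : m x y = Some 3%N by case: mC => <-.
  by have := @braid_move a b x y; rewrite /malt e m0; apply.
have py_lt : (p < y)%N by apply: ltn_trans xy.
have szR : size R = (size U).+1 by rewrite size_cat addn1.
have szW : size (blks m s s' 0 k.+2) = (size U + 5)%N by rewrite dec size_cat addnC.
have stp v : size v = (size U + 5)%N -> dllt (p :: v) w by rewrite -szW; exact: st.
have stx v : size v = (size U + 5)%N -> dllt (x :: v) w by rewrite -szW; exact: st.
have styp v : size v = (size U + 4)%N -> dllt [:: y, p & v] w.
  by move=> sz; apply: st2; rewrite szW sz; lia.
Ltac small stp stx styp szR :=
  rewrite /=; (apply: stp || apply: stx || apply: styp); rewrite /= ?szR; lia.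
have S1 : [:: y, p, x, p, y & R] ~ [:: p, y, x, p, y & R].
  by apply: congr_mod_sym; apply: (py [::]); small stp stx styp szR.
have S2 : [:: p, y, x, p, y & R] ~ [:: p, y, x, y, p & R].
  by apply: (py [:: p; y; x]); small stp stx styp szR.
have S3 : [:: p, y, x, y, p & R] ~ [:: p, x, y, x, p & R].
  by apply: congr_mod_sym; apply: (xyx [:: p]); small stp stx styp szR.
have S4 : [:: p, x, y, x, p & R] ~ [:: p, x, y, x, p, x & U].
  have := @carry s s' 3 k.+2 [:: p; x; y; x; p] [::].
  rewrite c3 cats0; apply=> // [j /andP[_ jk]|v sv].
    by split; [exact: chain_neq ch _ jk|split; [exact: chain_finite ch _ jk|exact: carriedE ch _ jk]].
  by apply: stp; rewrite cats0 /= sv -/U; lia.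
have S5 : [:: p, x, y, x, p, x & U] ~ [:: p, x, y, p, x, p & U].
  by apply: congr_mod_sym; apply: (pxp [:: p; x; y]); small stp stx styp szR.
have S6 : [:: p, x, y, p, x, p & U] ~ [:: p, x, p, y, x, p & U].
  by apply: congr_mod_sym; apply: (py [:: p; x]); small stp stx styp szR.
have S7 : [:: p, x, p, y, x, p & U] ~ [:: x, p, x, y, x, p & U].
  by apply: (pxp [::]); small stp stx styp szR.
have S8 : [:: x, p, x, y, x, p & U] ~ [:: x, p, y, x, y, p & U].
  by apply: (xyx [:: x; p]); small stp stx styp szR.
have S9 : [:: x, p, y, x, y, p & U] ~ [:: x, p, y, x, p, y & U].
  by apply: congr_mod_sym; apply: (py [:: x; p; y; x]); small stp stx styp szR.
have S10 : [:: x, p, y, x, p, y & U] ~ [:: x, y, p, x, p, y & U].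
  by apply: (py [:: x]); small stp stx styp szR.
have S11 : [:: x, y, p, x, p, y & U] ~ [:: x, y, x, p, x, y & U].
  by apply: (pxp [:: x; y]); small stp stx styp szR.
rewrite dec; apply: congr_mod_trans S1 _; apply: congr_mod_trans S2 _.
apply: congr_mod_trans S3 _; apply: congr_mod_trans S4 _.
apply: congr_mod_trans S5 _; apply: congr_mod_trans S6 _.
apply: congr_mod_trans S7 _; apply: congr_mod_trans S8 _.
apply: congr_mod_trans S9 _; apply: congr_mod_trans S10 _.
exact: S11.
Qed.

End CoxeterMoves.

Theorem theorem3p18 (F : fieldType) (n : nat) (m : 'M[option nat]_n)
    (k : nat) (s s' : nat -> 'I_n) (t t' : 'I_n) (i : nat) :
  coxeter_matrix m ->
  chain_data m k s s' ->
  (t' < t)%N -> m t t' != None ->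
  (i < k)%N ->
  let f := rel3 F m k s s' in
  let g := rel2 F m t t' in
  let u := blks m s s' in
  let x := xlast m s s' i in
  let y := ylast m s s' k.+1 in
  let a := u 0%N i ++ malt m 2 (s i) (s' i) in
  let b := malt m 2 (s' i.+2) (s i.+2) ++ u i.+3 k.+2 ++ [:: y] in
  let fg := inclusion_comp f g a b in
  lead f = a ++ lead g ++ b ->
  [/\ g = word F [:: x; s i.+1; x] - word F [:: s i.+1; x; s i.+1] /\
      (s i.+1 < x)%N,
      size (blk m s s' i) = 1%N \/ size (blk m s s' i) = 2%N ->
        congr_mod (coxS m) (lead f) fg 0
    & (2 < size (blk m s s' i))%N ->
        congr_mod (coxS m) (lead f) fg
          (word F (u 0%N i ++ malt m 3 (s i) (s' i)
                   ++ [:: s i.+1; s' i.+1; x; s i.+1]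
                   ++ malt m 2 (s' i.+2) x ++ u i.+3 k.+2 ++ [:: y])
           - word F (s' 0%N :: u 0%N k.+2))].
Proof.
move=> mC chd tt fin_t ik f g u x y a b fg hl.
have ch : linked m k s s' by case: chd.
have i0k : (i <= k.+1)%N by lia.
have i1k : (i.+1 <= k.+1)%N by lia.
have [et et' m3] := overlap_shape mC ch tt fin_t ik hl.
rewrite -/x in et m3 * => -[m1 e2 e2'].
have px : (s i.+1 < x)%N by rewrite -et -et'.
have m3' : m (s i.+1) x = Some 3%N by case: mC => <-.
have gE : g = word F [:: x; s i.+1; x] - word F [:: s i.+1; x; s i.+1].
  by rewrite /g /rel2 /malt et et' m3 m3'.
have lg : lead g = [:: x; s i.+1; x].
  by rewrite gE lead_sub_words //; apply: (@dllt_first _ [::]).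
have hl2 := hl; rewrite lg in hl2.
have lf := lead_rel3 F mC ch; rewrite -/f in lf.
have fE : f = word F (a ++ [:: x; s i.+1; x] ++ b) - word F (s' 0%N :: u 0%N k.+2).
  by rewrite -hl2 lf; exact: rel3E.
have fgE : fg = word F (a ++ [:: s i.+1; x; s i.+1] ++ b)
                - word F (s' 0%N :: u 0%N k.+2).
  rewrite /fg /inclusion_comp gE.
  rewrite word_subM.
  rewrite fE.
  exact: subrBB.
have [l ml] := chain_order mC ch i0k.
have szb : size (blk m s s' i) = l.+1 by rewrite (blkE ml) size_alt.
have y1 : s' i.+1 = ylast m s s' i by apply: carriedE ch _ i1k.
have null : congr_mod (coxS m) (lead f) (word F (a ++ [:: s i.+1; x; s i.+1] ++ b))
    (word F (s' 0%N :: u 0%N k.+2)) -> congr_mod (coxS m) (lead f) fg 0.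
  exact: congr_mod_null fgE.
split=> //.
  rewrite szb => -[[l0]|[l1]]; apply: null.
  - rewrite l0 in ml.
    have ex : x = s i by rewrite /x /xlast (blkE ml).
    have := @overlap_commuting F n m (lead f) mC k s s' i ch ik ml m1.
    rewrite ex in e2 m3 px *; move=> /(_ e2 e2' m3 px lf).
    have m2 : m (s' i.+2) (s i.+2) = Some 2%N.
      by rewrite e2 e2' y1 (ylastE ml) /=; case: mC => <-.
    by rewrite /a /b /malt ml m2 /= cats0.
  rewrite l1 in ml.
  have ex : x = s' i by rewrite /x /xlast (blkE ml).
  have ey : s' i.+1 = s i by rewrite y1 (ylastE ml).
  (* For i > 0 the chain would give both x > y, from the block u_i, and x < y. *)
  have i0 : i = 0%N.
    case: (posnP i) => [//|i_gt0].
    have lt1 : (s i < s' i)%N by apply: (chain_ascent ch); rewrite i_gt0.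
    have lt2 : (s i.+2 < s' i.+2)%N by apply: (chain_ascent ch).
    by rewrite e2 e2' ey ex ltnNge (ltnW lt1) in lt2.
  subst i; have m2 : m (s' 2%N) (s 2%N) = Some 3%N by rewrite e2 e2' ey ex.
  have := @overlap_order3 F n m (lead f) mC k s s' ch ik ml m1.
  rewrite ex in e2 m3 px *; move=> /(_ e2 e2' m3 px lf).
  by rewrite /a /b /malt ml m2 e2' ey.
rewrite szb !ltnS => l2.
apply: congr_mod_subr fgE _.
case: l ml l2 {szb} => [//|l] ml _.
have aE : malt m 2 (s i) (s' i) = malt m 3 (s i) (s' i) ++ [:: s' i.+1].
  by rewrite y1 (ylastE ml) /malt ml !subSS !subn0 alt_rcons cats1 /= negbK.
have py : (s i.+1 < s' i.+1)%N by apply: (chain_ascent ch).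
have bE : b = malt m 2 (s' i.+2) x ++ u i.+3 k.+2 ++ [:: y] by rewrite /b e2.
have := @commute_overlap F n m (lead f) mC (u 0%N i ++ malt m 3 (s i) (s' i)) b
  (s i.+1) x (s' i.+1) m1 px py.
rewrite hl2 /a aE bE -!catA => com; exact: com erefl.
Qed.
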